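(* Let $C_5$ be the family of all functions $f:\mathbb{Z}/5\mathbb{Z}\to\{0,1\}$ for which there is some $i\in\mathbb{Z}/5\mathbb{Z}$ with $f(i)=1$, $f(i+1)=0$, $f(i+2)=0$, $f(i+3)=1$. Then $\mathrm{UCS}(C_5)=3$.
   Context: Let $B$ be a finite set and $\mathcal{F}$ a family of functions $B\to\{0,1\}$. A partial function of $\mathcal{F}$ is a restriction $f|_S$ with $f\in\mathcal{F}$ and $S\subseteq B$; its domain is $S$. An unlabeled compression scheme for $\mathcal{F}$ is a pair of operations $(\alpha,\beta)$ such that: (i) $\alpha$ assigns to each partial function $g$ of $\mathcal{F}$ with domain $S$ a subset $\alpha(g)\subseteq S$; (ii) $\beta$ takes as input a set output by $\alpha$ (a subset of $B$) and returns an arbitrary function $B\to\{0,1\}$ (not required to belong to $\mathcal{F}$); (iii) for every partial function $g$ of $\mathcal{F}$ with domain $S$, $\beta(\alpha(g))$ is an extension of $g$, i.e. $\beta(\alpha(g))|_S=g$. The size of the scheme is the maximum of $|\alpha(g)|$ over all partial functions $g$ of $\mathcal{F}$. $\mathrm{UCS}(\mathcal{F})$ denotes the minimum size of an unlabeled compression scheme for $\mathcal{F}$. (The family $C_5$ has $10$ members; its domain is thought of as the vertices of a regular pentagon in cyclic order.) *)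

(* Defs.v *)
From mathcomp Require Import all_boot all_order all_algebra.

Set Implicit Arguments.
Unset Strict Implicit.
Unset Printing Implicit Defensive.

Import GRing.Theory.

Section UnlabeledCompression.
Variable B : finType.
Implicit Types (f : {ffun B -> bool}) (S : {set B}) (F : {set {ffun B -> bool}}).

(* A function with domain S is encoded by the value None outside S, so that
   equal partial functions have equal domains. *)
Definition pfun := {ffun B -> option bool}.

Definition pdom (g : pfun) : {set B} := [set x | g x != None].

Definition restr f S : pfun := [ffun x => if x \in S then Some (f x) else None].

Definition partials F : {set pfun} := [set restr f S | f in F, S in [set: {set B}]].

(* A pair (alpha, beta).  Both maps are total: the values of alpha off
   partials F, and those of beta off the range of alpha on partials F, are
   constrained neither by is_ucs nor by ucs_size. *)
Definition scheme : finType :=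
  ({ffun pfun -> {set B}} * {ffun {set B} -> {ffun B -> bool}})%type.

Definition is_ucs F (s : scheme) : bool :=
  [forall g in partials F,
     (s.1 g \subset pdom g) && (restr (s.2 (s.1 g)) (pdom g) == g)].

Definition ucs_size F (s : scheme) : nat := \max_(g in partials F) #|s.1 g|.

Definition has_ucs_of_size F (k : nat) : bool :=
  [exists s : scheme, is_ucs F s && (ucs_size F s == k)].

(* Witness: alpha g = g^-1(1), beta A = the indicator function of A. *)
Lemma ex_ucs F : exists k, has_ucs_of_size F k.
Proof.
pose s : scheme := ([ffun g : pfun => [set x | g x == Some true]],
                    [ffun A : {set B} => [ffun x => x \in A]]).
exists (ucs_size F s); apply/existsP; exists s; rewrite eqxx andbT.
apply/forall_inP => g _; apply/andP; split.
  by apply/subsetP => x; rewrite ffunE !inE => /eqP ->.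
apply/eqP/ffunP => x; rewrite !ffunE !inE.
by case: (g x) => [[]|].
Qed.

Definition UCS F : nat := ex_minn (ex_ucs F).

End UnlabeledCompression.

Definition C5 : {set {ffun 'Z_5 -> bool}} :=
  [set f : {ffun 'Z_5 -> bool} |
    [exists i : 'Z_5, [&& f i == true, f (i + 1)%R == false,
                          f (i + 2%:R)%R == false & f (i + 3%:R)%R == true]]].

(* Main.v *)
(* Members of C5 have at most three ones, so alpha g = g^-1(1) has size 3.

   Suppose a scheme had size at most 2. C5 has on any S with |S| <= 3 exactly as
   many traces as S has subsets of size at most 2, so alpha is a bijection
   between the two; hence, for such subsets A of S, beta A restricted to S is a
   trace of C5 that determines A. Let d_A = beta A + beta 0 (mod 2), so that
   d_{x}(x) = 1, and draw an arc x -> y if d_{x}(y) = 1. No edge is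
   bidirected. Each triple misses exactly one trace, which shows first that
   beta 0 is in C5, say with beginning 1001 at i. Then, for each vertex x of the
   4-cycle i, i+1, i+3, i+2 with neighbours y, z, no d_A is (1,0,0) on
   (x,y,z). So x has an arc to y or z, and x -> y, z -> x imply z -> y. The arcs
   therefore circulate around the 4-cycle, and the implication applied at i+1
   and at i+2 gives both i -> i+3 and i+3 -> i, a contradiction. *)

Require Import Defs.
From mathcomp Require Import all_boot all_order all_algebra.

Set Implicit Arguments.
Unset Strict Implicit.
Unset Printing Implicit Defensive.

Import GRing.Theory.

(** * Compression schemes of an arbitrary family *)

Section Compression.
Variables (B : finType) (F : {set {ffun B -> bool}}).
Implicit Types (f : {ffun B -> bool}) (S A : {set B}) (s : scheme B).

Lemma pdom_restr f S : pdom (restr f S) = S.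
Proof. by apply/setP => x; rewrite inE ffunE; case: (x \in S). Qed.

Lemma restr_in_partials f S : f \in F -> restr f S \in partials F.
Proof. by move=> Ff; apply/imset2P; exists f S; rewrite ?inE. Qed.

Lemma eq_restrP f f' S : reflect {in S, f =1 f'} (restr f S == restr f' S).
Proof.
apply: (iffP eqP) => [/ffunP e x xS | e].
  by have := e x; rewrite !ffunE xS => -[].
by apply/ffunP => x; rewrite !ffunE; case: ifP => // xS; rewrite e.
Qed.

(* A counting argument: alpha is injective on the traces on S, so if these are
   at least as many as the available values then every value is attained. *)
Lemma ucs_surj s k S A :
    is_ucs F s -> ucs_size F s <= k ->
    #|[set A : {set B} | (A \subset S) && (#|A| <= k)]| <=
      #|[set restr f S | f in F]| ->
    A \subset S -> #|A| <= k ->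
  exists f, [/\ f \in F, s.1 (restr f S) = A & {in S, s.2 A =1 f}].
Proof.
move=> /forall_inP us /bigmax_leqP sk le_card AS Ak.
have sP f : f \in F -> s.1 (restr f S) \subset S /\
                       {in S, s.2 (s.1 (restr f S)) =1 f}.
  move=> /(restr_in_partials S) /us; rewrite pdom_restr.
  by case/andP=> -> /eq_restrP.
have inj : {in [set restr f S | f in F] &, injective s.1}.
  move=> _ _ /imsetP[f Ff ->] /imsetP[f' Ff' ->] e; apply/eqP/eq_restrP => x xS.
  by rewrite -(sP f Ff).2 // e (sP f' Ff').2.
have sub : s.1 @: [set restr f S | f in F] \subset
           [set A : {set B} | (A \subset S) && (#|A| <= k)].
  apply/subsetP => _ /imsetP[_ /imsetP[f Ff ->] ->]; rewrite inE (sP f Ff).1.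
  exact/sk/restr_in_partials.
have /eqP E : s.1 @: [set restr f S | f in F] ==
           [set A : {set B} | (A \subset S) && (#|A| <= k)].
  by rewrite eqEcard sub card_in_imset.
have: A \in s.1 @: [set restr f S | f in F] by rewrite E inE AS.
case/imsetP=> _ /imsetP[f Ff ->] ->; exists f; split=> //; exact: (sP f Ff).2.
Qed.

(** On [S], the reconstruction from [A] is a trace that [s.1] sends back to [A], so it determines
    [A]. *)
Lemma ucs_inj s k S A A' :
    is_ucs F s -> ucs_size F s <= k ->
    #|[set A : {set B} | (A \subset S) && (#|A| <= k)]| <=
      #|[set restr f S | f in F]| ->
    A \subset S -> #|A| <= k -> A' \subset S -> #|A'| <= k ->
  {in S, s.2 A =1 s.2 A'} -> A = A'.
Proof.
move=> us sk le_card AS Ak AS' Ak' e.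
have [f [_ eA ef]] := ucs_surj us sk le_card AS Ak.
have [f' [_ eA' ef']] := ucs_surj us sk le_card AS' Ak'.
by rewrite -eA -eA'; congr (s.1 _); apply/eqP/eq_restrP => x xS; rewrite -ef // e // ef'.
Qed.

Lemma indicator_ucs k : (forall f, f \in F -> #|[set x | f x]| <= k) ->
  exists2 s : scheme B, is_ucs F s & ucs_size F s <= k.
Proof.
move=> Fk; pose s : scheme B :=
  ([ffun g : pfun B => [set x | g x == Some true]],
   [ffun A : {set B} => [ffun x => x \in A]]).
have sE f S : s.1 (restr f S) = [set x in S | f x].
  by rewrite ffunE; apply/setP => x; rewrite !inE ffunE; case: ifP; case: (f x).
exists s.
  apply/forall_inP => _ /imset2P[f S _ _ ->]; rewrite pdom_restr sE.
  rewrite setIdE subsetIl; apply/eq_restrP => x xS.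
  by rewrite !ffunE !inE xS.
apply/bigmax_leqP => _ /imset2P[f S Ff _ ->]; rewrite sE setIdE.
by rewrite (leq_trans (subset_leq_card (subsetIr _ _))) ?Fk.
Qed.

Lemma card_small_subsets2 S : #|S| <= 3 ->
  #|[set A : {set B} | (A \subset S) && (#|A| <= 2)]| = 2 ^ #|S| - (#|S| == 3).
Proof.
rewrite leq_eqVlt ltnS => /predU1P[S3 | S2]; last first.
  rewrite ltn_eqF ?ltnS // subn0 -card_powerset; apply: eq_card => A.
  rewrite !inE andb_idr // => /subset_leq_card AS; exact: leq_trans AS S2.
have -> : [set A : {set B} | (A \subset S) && (#|A| <= 2)] = powerset S :\ S.
  apply/setP => A; rewrite !inE andbC; have [AS /= | _] := boolP (A \subset S).
    by rewrite eqEcard AS -ltnNge S3 andbT.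
  by rewrite !andbF.
have := cardsD1 S (powerset S).
by rewrite powersetE subxx card_powerset S3 add1n subn1 => ->.
Qed.

End Compression.

(** * The digraph of arcs of a reconstruction map *)

Section Arcs.
Variables (B : finType) (beta : {set B} -> B -> bool).
Hypothesis beta_inj : forall S A A' : {set B}, #|S| <= 3 ->
  A \subset S -> #|A| <= 2 -> A' \subset S -> #|A'| <= 2 ->
  {in S, beta A =1 beta A'} -> A = A'.

(** This is d_A; adding [beta set0] preserves injectivity and normalizes the value at the empty set
    to 0. *)
Definition flip A x := beta A x (+) beta set0 x.
Definition arc x y := flip [set x] y.
Definition avoids x y z := forall A : {set B}, A \subset [set x; y; z] ->
  #|A| <= 2 -> ~~ [&& flip A x, ~~ flip A y & ~~ flip A z].

Lemma flip_inj (S A A' : {set B}) : #|S| <= 3 ->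
  A \subset S -> #|A| <= 2 -> A' \subset S -> #|A'| <= 2 ->
  {in S, flip A =1 flip A'} -> A = A'.
Proof.
move=> S3 AS A2 AS' A2' e; apply: (beta_inj S3) => // x xS.
exact: addIb (e x xS).
Qed.

Lemma flip0 x : flip set0 x = false.
Proof. exact: addbb. Qed.

Lemma flip1 x : flip [set x] x.
Proof.
apply/idPn => /negPf n.
have /setP/(_ x) : [set x] = set0 :> {set B}; last by rewrite !inE eqxx.
apply: (@flip_inj [set x]); rewrite ?cards1 ?cards0 ?sub0set //.
by move=> y /set1P ->; rewrite n flip0.
Qed.

Lemma card_set2_le (x y : B) : #|[set x; y]| <= 2.
Proof. by rewrite cards2; case: (x == y). Qed.

Lemma card_set3_le (x y z : B) : #|[set x; y; z]| <= 3.
Proof. by rewrite setUC cardsU1 (leq_add (leq_b1 _) (card_set2_le x y)). Qed.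

Lemma arc_asym x y : x != y -> arc x y -> ~~ arc y x.
Proof.
move=> xy a; apply/negP => b.
have /setP/(_ x) : [set x] = [set y]; last by rewrite !inE eqxx (negPf xy).
apply: (@flip_inj [set x; y]); rewrite ?cards1 ?subsetUl ?subsetUr //.
  by rewrite (leq_trans (card_set2_le x y)).
by move=> z /set2P[] ->; rewrite flip1; [rewrite [RHS]b | rewrite [LHS]a].
Qed.

(** The four subsets of the pair have distinct patterns on (x, y); the empty set, [[set x]] and
    [[set y]] take 00, 11 and 01, which leaves 10. *)
Lemma flip_arc x y : x != y -> arc x y ->
  flip [set x; y] x /\ ~~ flip [set x; y] y.
Proof.
move=> xy a; have a1 : flip [set x] y := a.
have b0 : flip [set y] x = false := negPf (arc_asym xy a).
have S3 : #|[set x; y]| <= 3 by rewrite (leq_trans (card_set2_le x y)).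
have nx (A : {set B}) : A \subset [set x; y] -> #|A| <= 2 ->
    [set x; y] != A ->
    ~~ ((flip [set x; y] x == flip A x) && (flip [set x; y] y == flip A y)).
  move=> AS A2; apply: contra => /andP[/eqP ex /eqP ey].
  apply/eqP/(flip_inj S3) => //; first exact: card_set2_le.
  by move=> z /set2P[] ->.
have := nx set0 (sub0set _); rewrite cards0 !flip0 => /(_ isT).
have := nx [set x] (subsetUl _ _); rewrite cards1 flip1 a1 => /(_ isT).
have := nx [set y] (subsetUr _ _); rewrite cards1 flip1 b0 => /(_ isT).
have -> : [set x; y] != [set y].
  by apply/eqP => /setP/(_ x); rewrite !inE eqxx (negPf xy).
have -> : [set x; y] != [set x].
  by apply/eqP => /setP/(_ y); rewrite !inE eqxx orbT eq_sym (negPf xy).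
have -> : [set x; y] != set0.
  by apply/eqP => /setP/(_ x); rewrite !inE eqxx.
move=> /(_ isT) + /(_ isT) + /(_ isT).
by case: (flip _ x) (flip _ y) => [] [].
Qed.

Lemma avoids_arc x y z : avoids x y z -> arc x y || arc x z.
Proof.
move/(_ [set x]); rewrite cards1 sub1set !inE eqxx flip1 => /(_ isT isT) /=.
by rewrite negb_and !negbK.
Qed.

(* As [flip [set x; y]] is 1 at x and 0 at y, it must be 1 at z; were there no
   arc from z to y, it would agree with [flip [set z]] on x, y, z. *)
Lemma avoids_trans x y z : x != y -> x != z -> avoids x y z ->
  arc x y -> arc z x -> arc z y.
Proof.
move=> xy xz av a b; have [fx fy] := flip_arc xy a.
have sub : [set x; y] \subset [set x; y; z] by apply: subsetUl.
have := av _ sub (card_set2_le _ _); rewrite fx fy /= negbK => fz.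
apply/idPn => /negPf c.
have /setP/(_ x) : [set x; y] = [set z]; last first.
  by rewrite !inE eqxx (negPf xz).
apply: (flip_inj (card_set3_le x y z)) => //.
- exact: card_set2_le.
- by rewrite subsetUr.
- by rewrite cards1.
move=> w; rewrite !inE -orbA => /or3P[] /eqP ->.
- by rewrite fx [RHS]b.
- by rewrite (negPf fy) [RHS]c.
- by rewrite fz flip1.
Qed.

Lemma avoidsC x y z : avoids x y z -> avoids x z y.
Proof. by move=> av A; rewrite setUAC [(~~ _) && _]andbC; apply: av. Qed.

(* Along the 4-cycle every vertex has an arc to a neighbour, and no edge is
   bidirected, so the arcs circulate in one direction. *)
Lemma avoids_4cycle a u b v : uniq [:: a; u; b; v] ->
  avoids a u v -> avoids u b a -> avoids b v u -> avoids v a b -> False.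
Proof.
rewrite /= !inE !negb_or andbT => /and3P[/and3P[au ab av] /andP[ub uv] bv].
move=> aP uP bP vP.
have next x y z : x != y -> avoids y z x -> arc x y -> arc y z.
  by move=> xy /avoids_arc yP /(arc_asym xy)/negPf n; rewrite n orbF in yP.
(* Exchanging [a] and [b] reverses the cycle. *)
wlog a_ub : a b au ab av ub bv aP uP bP vP / arc u b => [IH|].
  have /orP[ub1 | ua1] := avoids_arc uP; first exact: (IH a b).
  by apply: (IH b a); rewrite // 1?eq_sym //; apply: avoidsC.
have a_bv := next _ _ _ ub bP a_ub.
have a_va := next _ _ _ bv vP a_bv.
have a_au : arc a u by apply: (next v); rewrite // eq_sym.
have /(arc_asym ab)/negP[] : arc a b.
  by apply: avoids_trans uP a_ub a_au; rewrite // eq_sym.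
by apply: avoids_trans vP a_va a_bv; rewrite // eq_sym.
Qed.

End Arcs.

(** * The family [C5] and its traces, by finite computation *)

Definition residues : seq 'Z_5 := [seq inZp k | k <- iota 0 5].

Lemma mem_residues (i : 'Z_5) : i \in residues.
Proof. by case: i => [[|[|[|[|[|]]]]]]. Qed.

Lemma exists_Z5 (P : pred 'Z_5) :
  [exists i, P i] = has (fun k => P (inZp k)) (iota 0 5).
Proof.
rewrite -(has_map _ P); apply/existsP/hasP => [[i Pi] | [i _ Pi]]; last by exists i.
by exists i; rewrite // mem_residues.
Qed.

Lemma forall_Z5 (P : pred 'Z_5) :
  [forall i, P i] = all (fun k => P (inZp k)) (iota 0 5).
Proof.
rewrite -(all_map _ P); apply/forallP/allP => [Pi i _ // | Pi i].
by rewrite Pi ?mem_residues.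
Qed.

(** The two zeros in the pattern 1001 leave only three positions for ones. *)
Lemma card_C5 f : f \in C5 -> #|[set x | f x]| <= 3.
Proof.
rewrite inE => /existsP[i /and4P[_ /eqP f1 /eqP f2 _]].
have c : #|~: [set (i + 1)%R; (i + 2%:R)%R]| = 3.
  by rewrite cardsCs setCK cards2 (inj_eq (addrI i)) card_ord.
rewrite -[leqRHS]c; apply/subset_leq_card/subsetP => x; rewrite !inE => fx.
by apply/norP; split; apply: contraTneq fx => ->; rewrite ?f1 ?f2.
Qed.

(* C5 consists of the functions with neither the pattern 000 on i, i+1, i+2 nor
   the pattern 111 on i, i+1, i+3: each triple excludes exactly one pattern. *)
Lemma C5P (f : {ffun 'Z_5 -> bool}) :
  (f \in C5) = [forall i : 'Z_5,
     (f i || f (i + 1)%R || f (i + 2%:R)%R) &&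
     ~~ [&& f i, f (i + 1)%R & f (i + 3%:R)%R]].
Proof.
(* Over [nat], both sides compute to boolean expressions in [g 0], ..., [g 4]. *)
have [g fE] : exists g : nat -> bool, forall i, f i = g (val i).
  by exists (f \o inZp) => i; rewrite /= valZpK.
rewrite inE exists_Z5 forall_Z5.
under eq_has do rewrite !fE.
under eq_all do rewrite !fE.
vm_compute.
by case: (g 0) (g 1) (g 2) (g 3) (g 4) => [] [] [] [] [].
Qed.

(** The ten members of [C5]: 1001x for both values of x, in all rotations. *)
Definition C5_words : seq (seq bool) :=
  [seq rot k w | w <- [:: [:: true; false; false; true; false];
                          [:: true; false; false; true; true]], k <- iota 0 5].

Definition fun_of_word (w : seq bool) : {ffun 'Z_5 -> bool} :=
  [ffun i : 'Z_5 => nth false w i].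

Lemma C5_words_sub w : w \in C5_words -> fun_of_word w \in C5.
Proof.
apply/allP: w; under eq_all => w do [rewrite inE exists_Z5; under eq_has do rewrite !ffunE].
by vm_compute.
Qed.

Lemma card_mem_residues (S : {set 'Z_5}) :
  #|S| = count id [seq i \in S | i <- residues].
Proof.
rewrite count_map -size_filter cardE; apply/perm_size/uniq_perm.
- exact: enum_uniq.
- by rewrite filter_uniq.
- by move=> i; rewrite mem_enum mem_filter mem_residues andbT.
Qed.

(** Reading a trace as the word of its values along [S] can only merge traces, so it suffices to
    count distinct words, for each of the 32 membership masks [m] of [S] with at most three elements
    marked. *)
Lemma card_traces_C5 (S : {set 'Z_5}) : #|S| <= 3 ->
  2 ^ #|S| - (#|S| == 3) <= #|[set restr f S | f in C5]|.
Proof.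
pose m := [seq i \in S | i <- residues].
pose code (g : pfun 'Z_5) := [seq g i == Some true | i <- residues & i \in S].
have codeE w : code (restr (fun_of_word w) S) = mask m (mkseq (nth false w) 5).
  rewrite -[mkseq _ _]/[seq nth false w (val i) | i <- residues] -map_mask.
  rewrite -filter_mask; apply/eq_in_map => i; rewrite mem_filter => /andP[iS _].
  by rewrite !ffunE iS; case: nth.
move=> S3; pose t := undup [seq mask m (mkseq (nth false w) 5) | w <- C5_words].
have: size t <= #|[set restr f S | f in C5]|.
  rewrite cardE -(size_map code); apply: uniq_leq_size; first exact: undup_uniq.
  move=> x; rewrite mem_undup => /mapP[w ww ->]; rewrite -codeE.
  apply: map_f; rewrite mem_enum; apply/imsetP.
  by exists (fun_of_word w); first exact: C5_words_sub.
apply: leq_trans; move: S3; rewrite {}/t card_mem_residues -/m.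
have : size m = 5 by [].
by case: m {codeE} => [|[] [|[] [|[] [|[] [|[] []]]]]].
Qed.

Theorem theorem6 : UCS C5 = 3.
Proof.
rewrite /UCS; case: ex_minnP => k /existsP[s /andP[us /eqP sk]] k_min.
have k3 : k <= 3.
  have [s1 us1 s1k] := indicator_ucs card_C5; rewrite (leq_trans _ s1k) //.
  by apply: k_min; apply/existsP; exists s1; rewrite us1 /=.
apply/eqP; rewrite eqn_leq k3 /= ltnNge; apply/negP => k2.
have {sk k_min k3} sk : ucs_size C5 s <= 2 by rewrite sk.
have tight (S : {set 'Z_5}) : #|S| <= 3 ->
    #|[set A : {set 'Z_5} | (A \subset S) && (#|A| <= 2)]| <=
      #|[set restr f S | f in C5]|.
  by move=> S3; rewrite card_small_subsets2 // card_traces_C5.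
pose beta := s.2 : {set 'Z_5} -> {ffun 'Z_5 -> bool}.
have beta_inj (S A A' : {set 'Z_5}) : #|S| <= 3 ->
    A \subset S -> #|A| <= 2 -> A' \subset S -> #|A'| <= 2 ->
    {in S, beta A =1 beta A'} -> A = A'.
  by move=> /tight S3; apply: ucs_inj us sk S3.
have betaP (x y z : 'Z_5) (A : {set 'Z_5}) : A \subset [set x; y; z] -> #|A| <= 2 ->
    exists2 f, f \in C5 & [/\ beta A x = f x, beta A y = f y & beta A z = f z].
  move=> AS A2; have [f [Ff _ e]] := ucs_surj us sk (tight _ (card_set3_le x y z)) AS A2.
  by exists f => //; split; rewrite -e ?inE ?eqxx ?orbT.
(* On every triple [beta set0] agrees with a member of [C5], so it shows none of the patterns
   excluded in [C5P]. *)
have : beta set0 \in C5.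
  rewrite C5P; apply/forallP => i; apply/andP; split.
    have [|| f] := betaP i (i + 1)%R (i + 2%:R)%R set0; rewrite ?sub0set ?cards0 //.
    by rewrite C5P => /forallP/(_ i)/andP[+ _] [-> -> ->].
  have [|| f] := betaP i (i + 1)%R (i + 3%:R)%R set0; rewrite ?sub0set ?cards0 //.
  by rewrite C5P => /forallP/(_ i)/andP[_ +] [-> -> ->].
rewrite inE => /existsP[i /and4P[/eqP c0 /eqP c1 /eqP c2 /eqP c3]].
have n1 : (i + 1 + 1 = i + 2%:R)%R by rewrite -addrA.
have n2 : (i + 1 + 2%:R = i + 3%:R)%R by rewrite -addrA.
have n3 : (i + 2%:R + 1 = i + 3%:R)%R by rewrite -addrA -(natrD _ 2 1).
have n5 : (i + 2%:R + 3%:R = i)%R by rewrite -addrA -natrD pchar_Zp // addr0.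
(* For each vertex of this cycle and its two neighbours, the pattern excluded by [C5P] (000 or 111)
   differs from [beta set0] exactly at the vertex. *)
apply: (@avoids_4cycle _ _ beta_inj i (i + 1)%R (i + 3%:R)%R (i + 2%:R)%R).
- by move: (i) => [[|[|[|[|[|]]]]]].
- move=> A /betaP h /h[f]; rewrite C5P => /forallP/(_ i) + [ex ey ez].
  rewrite /flip ex ey ez c0 c1 c2.
  by case: (f i) (f (i + 1)%R) (f (i + 2%:R)%R) => [] [] [].
- move=> A /betaP h /h[f]; rewrite C5P => /forallP/(_ i)/andP[_ +] [ex ey ez].
  rewrite /flip ex ey ez c0 c1 c3.
  by case: (f i) (f (i + 1)%R) (f (i + 3%:R)%R) => [] [] [].
- move=> A /betaP h /h[f]; rewrite C5P => /forallP/(_ (i + 1)%R).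
  rewrite n1 n2 => /andP[+ _] [ex ey ez].
  rewrite /flip ex ey ez c1 c2 c3.
  by case: (f (i + 1)%R) (f (i + 2%:R)%R) (f (i + 3%:R)%R) => [] [] [].
- move=> A /betaP h /h[f]; rewrite C5P => /forallP/(_ (i + 2%:R)%R).
  rewrite n3 n5 => /andP[_ +] [ex ey ez].
  rewrite /flip ex ey ez c0 c2 c3.
  by case: (f i) (f (i + 2%:R)%R) (f (i + 3%:R)%R) => [] [] [].
Qed.
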